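(* Consider the smooth maps $\eta=\mathfrak H(n,z)$ and $p=\mathfrak P(n,z)$, defined for $n>0$, $z>0$ by $$\mathfrak H(n,z)=k_B\ln\Big\{4\pi e^4m_0^3c^3h^{-3}n^{-1}\frac{K_2(z)}{z}\exp\Big(z\frac{K_1(z)}{K_2(z)}\Big)\Big\},\qquad \mathfrak P(n,z)=m_0c^2\,n\,z^{-1}.$$ Then the map $(n,z)\mapsto\big(\mathfrak H(n,z),\mathfrak P(n,z)\big)$ is invertible with smooth inverse if $0<z\le 1/10$ or $z\ge 70$.
   Context: Here $m_0>0$ (particle rest mass), $c>0$ (speed of light), $k_B>0$ (Boltzmann's constant) and $h>0$ (Planck's constant) are fixed, and $e$ is Euler's number. For a relativistic fluid, $n$ is the proper number density, $z=m_0c^2/(k_B\theta)$ with $\theta$ the temperature, $\eta$ is the entropy per particle and $p$ is the pressure. For integers $j\ge0$ and $z>0$, $K_j(z)=\frac{2^j j!}{(2j)!}\,\frac{1}{z^{j}}\int_z^\infty e^{-\lambda}(\lambda^2-z^2)^{j-1/2}\,d\lambda$ (modified Bessel functions). *)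

(* Defs.v *)
From mathcomp Require Import all_boot all_order all_algebra.
From mathcomp Require Import all_classical all_reals all_analysis.

Set Implicit Arguments.
Unset Strict Implicit.
Unset Printing Implicit Defensive.

Import Order.TTheory GRing.Theory Num.Theory.
Import numFieldNormedType.Exports.

Local Open Scope classical_set_scope.
Local Open Scope ring_scope.

(* Meant for an open set U: values of f off U are then irrelevant, and when V
   is finite-dimensional this is the usual class C^k on U. *)
Fixpoint Ck_open (R : realType) (V W : normedModType R) (k : nat)
    (U : set V) (f : V -> W) : Prop :=
  match k with
  | 0%N => forall x, U x -> {for x, continuous f}
  | k'.+1 => (forall x, U x -> differentiable f x) /\
             (forall v : V, Ck_open k' U ('D_v f))
  end.

(* C^infinity on an arbitrary, not necessarily open, set A: near each point of
   A, the function f coincides on A with a C^infinity function defined on an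
   open neighborhood of that point. *)
Definition smooth_on (R : realType) (V W : normedModType R)
    (A : set V) (f : V -> W) : Prop :=
  forall a, A a -> exists (U : set V) (g : V -> W),
    [/\ open U, U a, forall k, Ck_open k U g &
        forall x, A x -> U x -> f x = g x].

Definition besselK (R : realType) (j : nat) (z : R) : R :=
  (2 ^+ j * (j`!)%:R / ((2 * j)`!)%:R) * (z ^+ j)^-1 *
  \int[@lebesgue_measure R]_(l in `]z, +oo[)
     (expR (- l) * (l ^+ 2 - z ^+ 2) `^ (j%:R - 2^-1)).

Definition entropy (R : realType) (m0 c kB h n z : R) : R :=
  kB * ln (4 * pi * expR 1 ^+ 4 * m0 ^+ 3 * c ^+ 3 * (h ^+ 3)^-1 * n^-1 *
           (besselK 2 z / z) * expR (z * (besselK 1 z / besselK 2 z))).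

Definition pressure (R : realType) (m0 c n z : R) : R :=
  m0 * c ^+ 2 * n * z^-1.

Definition entropy_pressure (R : realType) (m0 c kB h : R) (x : R * R)
    : R * R :=
  (entropy m0 c kB h x.1 x.2, pressure m0 c x.1 x.2).

(* Main.v *)
(* With p = m0 c^2 n / z the entropy becomes a function of p and z alone,
   eta / kB = const - ln p + phi z, so it suffices to invert phi on z > 0.
   Substituting l = z t, the Bessel functions turn into Laplace integrals
   M_k(z) = \int_1^oo t^k e^(-zt) sqrt(t^2 - 1) dt with M_k' = - M_(k+1):
   K_1 = z M_0 and, integrating by parts, K_2 = z M_1, whence
   phi = ln M_1 - ln z + z M_2 / M_1 up to a constant. Therefore
   phi' = - 1/z - z (M_1 M_3 - M_2^2) / M_1^2, which is negative for every z > 0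
   by the Cauchy-Schwarz inequality: phi is a diffeomorphism onto its open
   image, and the inverse is smooth on the image of the quadrant n, z > 0. *)
Require Import Defs.
From mathcomp Require Import all_boot all_order all_algebra.
From mathcomp Require Import all_classical all_reals all_analysis.
From mathcomp Require Import measurable_realfun ring lra.
Set Implicit Arguments.
Unset Strict Implicit.
Unset Printing Implicit Defensive.
Import Order.TTheory GRing.Theory Num.Theory.
Import numFieldNormedType.Exports.
Local Open Scope classical_set_scope.
Local Open Scope ring_scope.

(** * C^k functions on open sets *)

(** The first-order expansion of [f] at [a] is also one of [g], because the two agree near [a];
    uniqueness of the differential then identifies ['d g a]. *)
Lemma near_eq_differentiable (R : numFieldType) (V W : normedModType R)
    (f g : V -> W) (a : V) :
  {near a, f =1 g} -> differentiable f a -> differentiable g a.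
Proof.
move=> fg df; have [dfc fE] := (diff_locallyP a f).1 df.
have gE : g \o shift a = cst (g a) + 'd f a +o_ 0 id.
  apply/eqaddoP => e e0.
  have /eqaddoP /(_ e e0) := fE.
  have /= fg0 : \forall h \near 0, f (h + a) = g (h + a).
    move: fg; rewrite (near_shift 0) /=; apply: filter_app; near=> h.
    by rewrite subr0.
  apply: filter_app; apply: filter_app fg0; near=> h => fgh.
  by rewrite !fctE /= fgh (nbhs_singleton fg).
by apply/diff_locallyP; rewrite (diff_unique dfc gE).
Unshelve. all: by end_near. Qed.

Section CkOpen.
Variables (R : realType) (V : normedModType R).
Implicit Types (W : normedModType R) (U : set V).

(** The closure lemmas rest on this: a rule computing ['D_v] of a compound function holds only on
    [U], and its right-hand side may replace the derivative there in the induction on [k]. *)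
Lemma Ck_open_eq W k U (f g : V -> W) : open U -> {in U, f =1 g} ->
  Ck_open k U f -> Ck_open k U g.
Proof.
move=> oU; elim: k f g => [|k IH] f g fg /=.
  move=> cf x Ux; have fgx : {near x, f =1 g}.
    by near=> y; apply: fg; rewrite inE; near: y; exact: open_nbhs_nbhs.
  rewrite /prop_for /continuous_at -(fg x) ?inE//.
  by apply: cvg_trans (cf x Ux); apply: near_eq_cvg.
have fgx x : U x -> {near x, f =1 g}.
  move=> Ux; near=> y; apply: fg; rewrite inE; near: y.
  exact: open_nbhs_nbhs.
move=> [df Cf]; split=> [x Ux|v].
  by apply: near_eq_differentiable (df x Ux); exact: fgx.
apply: IH (Cf v) => x; rewrite inE => Ux.
by apply: near_eq_derive; exact: fgx.
Unshelve. all: by end_near. Qed.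

Lemma Ck_openW W k U U' (f : V -> W) : U' `<=` U ->
  Ck_open k U f -> Ck_open k U' f.
Proof.
move=> UU'; elim: k f => [|k IH] f /=; first by move=> cf x /UU'/cf.
by move=> [df Cf]; split=> [x /UU'/df//|v]; exact: IH.
Qed.

Lemma Ck_open_continuous W k U (f : V -> W) x : Ck_open k U f -> U x ->
  {for x, continuous f}.
Proof.
case: k => [|k] /=; first by move=> Cf; exact: Cf.
by move=> [df _] Ux; exact/differentiable_continuous/df.
Qed.

Lemma Ck_openS W k U (f : V -> W) : Ck_open k.+1 U f -> Ck_open k U f.
Proof.
elim: k f => [|k IH] f Cf.
  by move=> x Ux; exact: Ck_open_continuous Cf Ux.
by case: Cf => df Cf; split=> [|v]; [exact: df|exact: IH (Cf v)].
Qed.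

Lemma Ck_open_cst W k U (c : W) : Ck_open k U (cst c).
Proof.
elim: k c => [|k IH] c /=; first by move=> x _; exact: cst_continuous.
split=> // v; rewrite [X in Ck_open _ _ X](_ : _ = cst 0) //.
by apply/funext => x; rewrite derive_cst.
Qed.

Lemma Ck_open_linear W k U (f : {linear V -> W}) : open U -> continuous f ->
  Ck_open k U f.
Proof.
move=> oU cf; case: k => [|k] /=; first by move=> x _; exact: cf.
split=> [x _|v]; first exact: linear_differentiable.
apply: Ck_open_eq (Ck_open_cst k U (f v)) => // x _.
by rewrite deriveE ?diff_lin //; exact: linear_differentiable.
Qed.

Lemma Ck_openD W k U (f g : V -> W) : open U ->
  Ck_open k U f -> Ck_open k U g -> Ck_open k U (f \+ g).
Proof.
move=> oU; elim: k f g => [|k IH] f g /=.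
  by move=> cf cg x Ux; apply: continuousD; [exact: cf|exact: cg].
move=> [df Cf] [dg Cg]; split=> [x Ux|v].
  by apply: differentiableD; [exact: df|exact: dg].
apply: Ck_open_eq (IH _ _ (Cf v) (Cg v)) => // x; rewrite inE => Ux /=.
by rewrite deriveD//; apply: diff_derivable; [exact: df|exact: dg].
Qed.

Lemma Ck_openM k U (f g : V -> R) : open U ->
  Ck_open k U f -> Ck_open k U g -> Ck_open k U (f \* g).
Proof.
move=> oU; elim: k f g => [|k IH] f g.
  by move=> cf cg x Ux; apply: continuousM; [exact: cf|exact: cg].
(* The product rule involves [f] and [g] themselves, which the induction needs at order [k];
   [Ck_openS] supplies this. *)
move=> /[dup] /Ck_openS Cf' [df Cf] /[dup] /Ck_openS Cg' [dg Cg].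
split=> [x Ux|v].
  by apply: differentiableM; [exact: df|exact: dg].
apply: Ck_open_eq (Ck_openD oU (IH _ _ Cf' (Cg v)) (IH _ _ Cg' (Cf v))) => // x.
rewrite inE => Ux /=.
by rewrite deriveM//; apply: diff_derivable; [exact: df|exact: dg].
Qed.

Lemma Ck_open_pair W W' k U (f : V -> W) (g : V -> W') : open U ->
  Ck_open k U f -> Ck_open k U g -> Ck_open k U (fun x => (f x, g x)).
Proof.
move=> oU; elim: k f g => [|k IH] f g.
  by move=> cf cg x Ux; apply: cvg_pair; [exact: cf|exact: cg].
move=> [df Cf] [dg Cg]; split=> [x Ux|v].
  by apply: differentiable_pair; [exact: df|exact: dg].
apply: Ck_open_eq (IH _ _ (Cf v) (Cg v)) => // x; rewrite inE => Ux /=.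
rewrite [RHS]deriveE ?diff_pair ?deriveE//; try by [exact: df|exact: dg].
by apply: differentiable_pair; [exact: df|exact: dg].
Qed.

End CkOpen.

(** Induction through the chain rule: ['D_v (h \o f)] is the product of ['D_1 h \o f] and ['D_v f].
    A scalar outer function is enough for [ln], the reciprocal and [phi_inv]. *)
Lemma Ck_open_comp (R : realType) (V : normedModType R) k (U : set V)
    (I : set R) (f : V -> R) (h : R -> R) : open U ->
  (forall x, U x -> I (f x)) -> Ck_open k I h -> Ck_open k U f ->
  Ck_open k U (h \o f).
Proof.
move=> oU UI; elim: k h => [|k IH] h.
  move=> ch cf x Ux; apply: continuous_comp; first exact: cf.
  exact/ch/UI.
move=> [dh Ch] /[dup] /Ck_openS Cf' [df Cf]; split=> [x Ux|v].
  by apply: differentiable_comp; [exact: df|exact/dh/UI].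
apply: Ck_open_eq (Ck_openM oU (IH _ (Ch 1) Cf') (Cf v)) => // x.
rewrite inE => Ux /=.
have dhx := dh _ (UI _ Ux); have dfx := df _ Ux.
rewrite (deriveE v (differentiable_comp dfx dhx)) (diff_comp dfx dhx).
rewrite (deriveE _ dhx) (deriveE v dfx) /= mulrC.
(* The scalar ['d f x v] is pulled out of the linear map ['d h (f x)], leaving its value at 1. *)
by rewrite -[in RHS](mulr1 ('d f x v)) -[in RHS]/('d f x v *: 1) linearZ.
Qed.

(** On the line ['D_v f] is [v] times [f'], so the condition over all directions reduces to one
    derivative. The inductions for functions given by a derivative formula go through this. *)
Lemma Ck_open_is_derive (R : realType) k (I : set R) (f f' : R -> R) :
  open I -> (forall x, I x -> is_derive x 1 f (f' x)) -> Ck_open k I f' ->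
  Ck_open k.+1 I f.
Proof.
move=> oI ff' Cf'; have df x : I x -> differentiable f x.
  by move=> Ix; apply/derivable1_diffP; case: (ff' x Ix).
split=> // v; apply: Ck_open_eq (Ck_openM oI (Ck_open_cst k I v) Cf') => // x.
rewrite inE => Ix /=; have [_ <-] := ff' x Ix.
rewrite !(deriveE _ (df x Ix)).
by rewrite -[in RHS](mulr1 v) -[in RHS]/(v *: 1) linearZ.
Qed.

(** * Laplace integrals *)

Section Elementary.
Variable R : realType.

Lemma open_pos : open [set x : R | 0 < x].
Proof. exact: open_gt. Qed.

Lemma Ck_open_inv k : Ck_open k [set x : R | x != 0] GRing.inv.
Proof.
elim: k => [|k IH]; first by move=> x /= x0; exact: inv_continuous.
have oP := @open_neq R 0.
apply: (Ck_open_is_derive (f' := (cst (-1)) \* (GRing.inv \* GRing.inv))) => //.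
  move=> x /= x0.
  have -> : -1 * (x^-1 * x^-1) = - (id x) ^- 2 *: 1.
    by rewrite mulN1r -invfM -expr2 [RHS]mulr1.
  exact: is_deriveV (is_derive_id _ _).
by apply: Ck_openM; [|exact: Ck_open_cst|exact: Ck_openM].
Qed.

Lemma Ck_open_ln k : Ck_open k [set x : R | 0 < x] (@ln R).
Proof.
case: k => [|k]; first by move=> x /= x0; exact: continuous_ln.
have oP := open_pos.
apply: (Ck_open_is_derive (f' := GRing.inv)) => //.
by apply: Ck_openW (Ck_open_inv k) => x /= x0; rewrite gt_eqF.
Qed.

End Elementary.

Section Laplace.
Variable R : realType.
Local Notation mu := (@lebesgue_measure R).
Local Notation D := (`]1, +oo[%classic : set R).
Implicit Types (g : R -> R) (a z t : R).

(** Up to the factor [a^-1] this is the density of the exponential law. *)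
Lemma integrable_expRN a : 0 < a ->
  mu.-integrable D (EFin \o (fun t => expR (- (a * t)))).
Proof.
move=> a0; have aN0 : a != 0 by rewrite gt_eqF.
apply: (@eq_integrable _ _ _ mu _ _
  (fun t => (a^-1)%:E * (exponential_pdf a t)%:E)%E) => //.
  move=> t; rewrite inE/= in_itv/= andbT => t1.
  by rewrite exponential_pdfE ?(ltW (lt_trans ltr01 t1))// -EFinM mulKf// mulNr.
apply: integrableZl => //.
by apply: integrableS (integrable_exponential_pdf a0) => //.
Qed.

Lemma pow_le_expR a n : 0 < a -> exists2 C : R, 0 <= C &
  forall t, 1 <= t -> t ^+ n <= C * expR (a * t).
Proof.
(* The constant comes from the term of order [n.+1] of the exponential series at [a * t]; the
   surplus factor [t] is at least 1. *)
move=> a0; exists ((n.+1)`!%:R / a ^+ n.+1).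
  by rewrite divr_ge0// exprn_ge0// ltW.
move=> t t1; have t0 : 0 <= t := le_trans ler01 t1.
have a1 : 0 < a ^+ n.+1 by rewrite exprn_gt0.
have f0 : (0 : R) < (n.+1)`!%:R by rewrite ltr0n fact_gt0.
have := expR_ge1Dxn n (mulr_ge0 (ltW a0) t0); rewrite exprMn => H.
rewrite mulrAC ler_pdivlMr// [leRHS]mulrC -ler_pdivrMr//.
apply: le_trans H.
apply: le_trans (_ : _ <= a ^+ n.+1 * t ^+ n.+1 / n.+1`!%:R) _.
  2: by rewrite lerDr.
rewrite ler_pM2r ?invr_gt0// mulrC ler_pM2l//.
by rewrite exprS ler_peMl// exprn_ge0.
Qed.

(** A class of weights stable under multiplication by [t], hence under differentiation of the
    Laplace integral. Growth matters only on the range of integration; continuity on the whole line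
    gives measurability. *)
Definition tempered g := continuous g /\
  exists C n, forall t, 1 <= t -> `|g t| <= C * t ^+ n.

Lemma tempered_mulX g : tempered g -> tempered (fun t => t * g t).
Proof.
move=> [cg [C [n gC]]]; split.
  by move=> t; apply: continuousM; [exact: cvg_id|exact: cg].
exists C, n.+1 => t t1.
have t0 : 0 <= t := le_trans ler01 t1.
by rewrite normrM ger0_norm// exprS mulrCA ler_wpM2l// gC.
Qed.

Definition laplace g z := \int[mu]_(t in D) (expR (- (z * t)) * g t).

Lemma continuous_laplace_integrand g z : continuous g ->
  continuous (fun t => expR (- (z * t)) * g t).
Proof.
move=> cg t.
apply: (@continuousM _ _ (fun t => expR (- (z * t))) g); last exact: cg.
apply: continuous_comp; last exact: continuous_expR.
by apply: continuousN; exact: mulrl_continuous.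
Qed.

(** One half of the exponent [a] absorbs the polynomial growth of [g]; the other half remains as an
    integrable majorant, uniform in [z >= a]. *)
Lemma laplace_dominated g a : tempered g -> 0 < a -> exists2 C : R, 0 <= C &
  forall z t, a <= z -> 1 <= t ->
    `|expR (- (z * t)) * g t| <= C * expR (- (a / 2 * t)).
Proof.
move=> [cg [C [n gC]]] a0; have a2 : 0 < a / 2 by rewrite divr_gt0.
have [E E0 En] := pow_le_expR n a2.
have C0 : 0 <= C.
  by have := gC 1 (lexx _); rewrite expr1n mulr1; exact: le_trans.
exists (C * E); first exact: mulr_ge0.
move=> z t az t1; have t0 : 0 <= t := le_trans ler01 t1.
rewrite normrM ger0_norm ?expR_ge0//.
apply: (@le_trans _ _ (expR (- (a * t)) * (C * (E * expR (a / 2 * t))))).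
  apply: ler_pM; rewrite ?expR_ge0//.
    by rewrite ler_expR lerN2 ler_wpM2r.
  by apply: le_trans (gC _ t1) _; rewrite ler_wpM2l// En.
rewrite mulrC -!mulrA -expRD le_eqVlt; apply/orP; left; apply/eqP.
by congr (_ * (_ * expR _)); field.
Qed.

Lemma laplace_integrable g z : tempered g -> 0 < z ->
  mu.-integrable D (EFin \o (fun t => expR (- (z * t)) * g t)).
Proof.
move=> tg z0; have [C C0 gC] := laplace_dominated tg z0.
apply: (@le_integrable _ _ _ mu _ _ _
    (fun t => C%:E * (expR (- (z / 2 * t)))%:E)%E) => //.
- apply/measurable_EFinP; apply: measurable_funTS.
  apply: continuous_measurable_fun.
  by apply: continuous_laplace_integrand; case: tg.
- move=> t /=; rewrite in_itv/= andbT => t1; rewrite lee_fin.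
  by rewrite [leRHS]ger0_norm ?mulr_ge0 ?expR_ge0// gC// ltW.
- by apply: integrableZl => //; apply: integrable_expRN; rewrite divr_gt0.
Qed.

(** Differentiation under the integral sign, for parameters in []z / 2, z + 1[]: staying above
    [z / 2] gives a common majorant of the partial derivatives, with exponent [z / 2 / 2]. *)
Lemma is_derive_laplace g z : tempered g -> 0 < z ->
  is_derive z 1 (laplace g) (- laplace (fun t => t * g t) z).
Proof.
move=> tg z0; have tg' := tempered_mulX tg.
have z2 : 0 < z / 2 by rewrite divr_gt0.
have [C C0 gC] := laplace_dominated tg' z2.
have der (x t : R) : is_derive x 1 (fun x => expR (- (x * t)) * g t)
    (- (expR (- (x * t)) * (t * g t))).
  apply: is_derive_eq.
  rewrite /GRing.scale/= !(mulr0,mul0r,addr0,add0r,mulr1); ring.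
have d1 x t : partial1of2 (fun x t => expR (- (x * t)) * g t) x t =
    - (expR (- (x * t)) * (t * g t)).
  by rewrite partial1of2E; case: (der x t).
have Iz : `]z / 2, z + 1[%classic z.
  by rewrite /= in_itv/= gtr_pMr// ltrDl ltr01 andbT invf_lt1// ltr1n.
have pos x : `]z / 2, z + 1[%classic x -> 0 < x.
  by rewrite /= in_itv/= => /andP[zx _]; exact: lt_trans zx.
have := @cvg_differentiation_under_integral R _ _ mu
  (fun x t => expR (- (x * t)) * g t) D _ z (z/2) (z+1) Iz
  (fun x Ix => laplace_integrable tg (pos x Ix))
  (fun x t _ _ => @ex_derive _ _ _ _ _ _ _ (der x t))
  (fun t => C * expR (- (z / 2 / 2 * t))).
move=> /(_ (measurable_itv _)).
have e1 : forall y, 0 <= C * expR (- (z / 2 / 2 * y)).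
  by move=> y; rewrite mulr_ge0 ?expR_ge0.
move=> /(_ e1).
have e2 : mu.-integrable D (EFin \o (fun t => C * expR (- (z / 2 / 2 * t)))).
  apply: (integrableZl _ _ (integrable_expRN _)) => //.
  by rewrite divr_gt0.
move=> /(_ e2).
have e3 : forall x y, `]z / 2, z + 1[%classic x -> D y ->
   `|partial1of2 (fun x t => expR (- (x * t)) * g t) x y| <=
   C * expR (- (z / 2 / 2 * y)).
  move=> x y; rewrite /= !in_itv/= andbT => /andP[zx _] y1.
  by rewrite d1 normrN gC// ltW.
move=> /(_ e3) H.
have E : \int[mu]_(y in D) partial1of2 (fun x t => expR (- (x * t)) * g t) z y
    = - laplace (fun t => t * g t) z.
  rewrite -mulN1r /laplace -RintegralZl//; last exact: laplace_integrable.
  by apply: eq_Rintegral => t _; rewrite d1 mulN1r.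
rewrite E in H.
split.
  apply/cvg_ex; exists (- laplace (fun t => t * g t) z).
  by under eq_fun do rewrite /= [_ *: 1]mulr1.
by rewrite -derive1E; exact: (cvg_lim (@norm_hausdorff _ _) H).
Qed.

Lemma Ck_open_laplace k g : tempered g ->
  Ck_open k [set z : R | 0 < z] (laplace g).
Proof.
elim: k g => [|k IH] g tg.
  move=> z /= z0; apply/differentiable_continuous/derivable1_diffP.
  by case: (is_derive_laplace tg z0).
have oP := @open_pos R.
apply: (Ck_open_is_derive (f' := cst (-1) \* laplace (fun t => t * g t))) => //.
  move=> z z0; apply: is_derive_eq (is_derive_laplace tg z0) _.
  by rewrite /= mulN1r.
apply: Ck_openM => //; first exact: Ck_open_cst.
exact/IH/tempered_mulX.
Qed.

End Laplace.

(** * Closure properties of tempered functions *)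

Section Tempered.
Variable R : realType.
Implicit Types (f g : R -> R) (t : R).

Lemma tempered_cst (c : R) : tempered (fun=> c).
Proof.
split; first by move=> t; exact: cst_continuous.
by exists `|c|, 0%N => t t1; rewrite expr0 mulr1.
Qed.

Lemma tempered_id : tempered (@id R).
Proof.
split; first by move=> t; exact: cvg_id.
by exists 1, 1%N => t t1; rewrite expr1 mul1r ger0_norm// (le_trans ler01).
Qed.

Lemma temperedM f g : tempered f -> tempered g -> tempered (fun t => f t * g t).
Proof.
move=> [cf [C [n fC]]] [cg [E [m gE]]]; split.
  by move=> t; apply: continuousM; [exact: cf|exact: cg].
exists (C * E), (n + m)%N => t t1.
by rewrite normrM exprD mulrACA ler_pM// (fC, gE).
Qed.

Lemma temperedD f g : tempered f -> tempered g -> tempered (fun t => f t + g t).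
Proof.
move=> [cf [C [n fC]]] [cg [E [m gE]]]; split.
  by move=> t; apply: continuousD; [exact: cf|exact: cg].
have C0 : 0 <= C.
  by have := fC 1 (lexx _); rewrite expr1n mulr1; exact: le_trans.
have E0 : 0 <= E.
  by have := gE 1 (lexx _); rewrite expr1n mulr1; exact: le_trans.
exists (C + E), (n + m)%N => t t1.
apply: le_trans (ler_normD _ _) _; rewrite mulrDl lerD//.
  by apply: le_trans (fC _ t1) _; rewrite ler_wpM2l// ler_weXn2l// leq_addr.
by apply: le_trans (gE _ t1) _; rewrite ler_wpM2l// ler_weXn2l// leq_addl.
Qed.

Lemma temperedN f : tempered f -> tempered (fun t => - f t).
Proof.
move=> tf; rewrite [X in tempered X](_ : _ = fun t => -1 * f t).
  exact: temperedM (tempered_cst _) tf.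
by apply/funext => t; rewrite mulN1r.
Qed.

Lemma temperedX f n : tempered f -> tempered (fun t => f t ^+ n).
Proof.
move=> tf; elim: n => [|n IH].
  by under eq_fun do rewrite expr0; exact: tempered_cst.
by under eq_fun do rewrite exprS; exact: temperedM.
Qed.

Lemma tempered_sqrt f : tempered f -> tempered (fun t => Num.sqrt (f t)).
Proof.
move=> [cf [C [n fC]]]; split.
  by move=> t; apply: continuous_comp; [exact: cf|exact: sqrt_continuous].
have C0 : 0 <= C.
  by have := fC 1 (lexx _); rewrite expr1n mulr1; exact: le_trans.
exists (C + 1), n => t t1.
have tn : 1 <= t ^+ n by rewrite exprn_ege1.
rewrite ger0_norm ?sqrtr_ge0//.
(* The bound sqrt x <= 1 + |x| keeps the degree [n]; the extra 1 is absorbed by [t ^+ n >= 1]. *)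
apply: (@le_trans _ _ (1 + `|f t|)); last first.
  by rewrite mulrDl mul1r addrC lerD// fC.
have f1 : 0 <= 1 + `|f t| by rewrite addr_ge0.
rewrite -(ger0_norm f1) -sqrtr_sqr ler_wsqrtr//.
by apply: le_trans (ler_norm _) _; have := normr_ge0 (f t); nra.
Qed.

End Tempered.

(** * Linearity, monotonicity and integration by parts for Laplace integrals *)

Section LaplaceLinear.
Variable R : realType.
Local Notation mu := (@lebesgue_measure R).
Local Notation D := (`]1, +oo[%classic : set R).
Implicit Types (f g : R -> R) (a z t : R).

Lemma eq_laplace f g z : (forall t, 1 < t -> f t = g t) ->
  laplace f z = laplace g z.
Proof.
move=> fg; apply: eq_Rintegral => t; rewrite inE/= in_itv/= andbT => t1.
by rewrite fg.
Qed.

Lemma laplaceD f g z : tempered f -> tempered g -> 0 < z ->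
  laplace (fun t => f t + g t) z = laplace f z + laplace g z.
Proof.
move=> tf tg z0; rewrite /laplace -RintegralD//; try exact: laplace_integrable.
by apply: eq_Rintegral => t _; rewrite mulrDr.
Qed.

Lemma laplaceZ c f z : tempered f -> 0 < z ->
  laplace (fun t => c * f t) z = c * laplace f z.
Proof.
move=> tf z0; rewrite /laplace -RintegralZl//; last exact: laplace_integrable.
by apply: eq_Rintegral => t _; rewrite mulrCA.
Qed.

Lemma laplace_ge0 f z : (forall t, 1 < t -> 0 <= f t) -> 0 <= laplace f z.
Proof.
move=> f0; apply: Rintegral_ge0 => t; rewrite /= in_itv/= andbT => t1.
by rewrite mulr_ge0 ?expR_ge0 ?f0.
Qed.

Lemma le_laplace f g z : tempered f -> tempered g -> 0 < z ->
  (forall t, 1 < t -> f t <= g t) -> laplace f z <= laplace g z.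
Proof.
move=> tf tg z0 fg; apply: le_Rintegral => //; try exact: laplace_integrable.
move=> t; rewrite /= in_itv/= andbT => t1.
by rewrite ler_wpM2l ?expR_ge0 ?fg.
Qed.

Lemma cvg_expRN a : 0 < a -> expR (- (a * t)) @[t --> +oo] --> 0.
Proof.
move=> a0; apply: (@cvg_comp _ _ _ (fun t => a * t) (fun t => expR (- t)) _
  (pinfty_nbhs R)).
  exact: gt0_cvgMry.
exact: cvgr_expR.
Qed.

Lemma is_derive_expRN a t : is_derive t 1 (fun t => expR (- (a * t)))
  (- (a * expR (- (a * t)))).
Proof.
apply: is_derive_eq.
by rewrite /GRing.scale/= !(mulr0,mul0r,addr0,add0r,mulr1); ring.
Qed.

Lemma continuous_expRN a : continuous (fun t => expR (- (a * t))).
Proof.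
move=> t; apply: continuous_comp; last exact: continuous_expR.
by apply: continuousN; exact: mulrl_continuous.
Qed.

Lemma Rintegral_expRN a : 0 < a ->
  \int[mu]_(t in D) expR (- (a * t)) = a^-1 * expR (- a).
Proof.
move=> a0; rewrite Rintegral_itv_obnd_cbnd; last exact: integrable_expRN.
pose F t := - a^-1 * expR (- (a * t)).
have dF t : is_derive t 1 F (expR (- (a * t))).
  have := is_derive_expRN a t => dE; apply: is_derive_eq.
  by rewrite /GRing.scale/= mulrNN mulKf// gt_eqF.
rewrite (@Rintegral_ge0_continuous_FTC2y R _ F 1 0).
- by rewrite /F mulr1 sub0r mulNr opprK.
- by move=> t _; exact: expR_ge0.
- apply: continuous_subspaceT; exact: continuous_expRN.
- rewrite -(mulr0 (- a^-1)); apply: cvgMl_tmp; exact: cvg_expRN.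
- by move=> t _; case: (dF t).
- apply: cvg_at_right_filter; apply: cvgMl_tmp; exact: continuous_expRN.
- by move=> t _; rewrite derive1E; case: (dF t).
Qed.

(* Adding [C * expR (- (a * t))] to [h] makes the integrand nonnegative, which
   the library's fundamental theorem of calculus on half-lines requires. *)
Lemma Rintegral_FTC_decay (h H : R -> R) (C a : R) : 0 < a ->
  continuous h -> continuous H ->
  (forall t, 1 < t -> is_derive t 1 H (h t)) ->
  (forall t, 1 <= t -> `|h t| <= C * expR (- (a * t))) ->
  H t @[t --> +oo] --> 0 ->
  \int[mu]_(t in D) h t = - H 1.
Proof.
move=> a0 ch cH dH hC H0.
have ie : mu.-integrable D (EFin \o (fun t => C * expR (- (a * t)))).
  exact: (integrableZl _ _ (integrable_expRN a0)).
have ih : mu.-integrable D (EFin \o h).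
  apply: le_integrable ie => //.
    apply/measurable_EFinP; apply: measurable_funTS.
    exact: continuous_measurable_fun.
  move=> t /=; rewrite in_itv/= andbT => t1; rewrite lee_fin.
  by apply: le_trans (hC t (ltW t1)) _; exact: ler_norm.
pose F t := H t - C / a * expR (- (a * t)).
have ihe : mu.-integrable D (EFin \o (fun t => h t + C * expR (- (a * t)))).
  exact: (integrableD _ ih ie).
have dF t : 1 < t -> is_derive t 1 F (h t + C * expR (- (a * t))).
  move=> /dH dHt; have := is_derive_expRN a t => dE; apply: is_derive_eq.
  rewrite /GRing.scale/= mulrN opprK; congr (_ + _).
  by rewrite mulrA mulfVK// gt_eqF.
have FTC : \int[mu]_(t in `[1, +oo[) (h t + C * expR (- (a * t))) = 0 - F 1.
  apply: Rintegral_ge0_continuous_FTC2y.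
  - move=> t t1; have := hC t t1; rewrite ler_norml => /andP[+ _].
    by rewrite -subr_ge0 opprK.
  - apply: continuous_subspaceT => t; apply: cvgD; first exact: ch.
    apply: cvgMl_tmp; exact: continuous_expRN.
  - rewrite -(subr0 0) -[X in _ - X](mulr0 (C / a)); apply: cvgB => //.
    by apply: cvgMl_tmp; exact: cvg_expRN.
  - by move=> t /dF[].
  - apply: cvg_at_right_filter; apply: cvgB; first exact: cH.
    apply: cvgMl_tmp; exact: continuous_expRN.
  - by move=> t; rewrite in_itv/= andbT derive1E => /dF[].
move: FTC; rewrite -Rintegral_itv_obnd_cbnd// RintegralD// RintegralZl//.
2: exact: integrable_expRN.
rewrite Rintegral_expRN// /F mulr1 => /eqP; rewrite -subr_eq0 => /eqP E.
apply/eqP; rewrite -subr_eq0 -E; apply/eqP; ring.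
Qed.

(* The hypothesis on H says that expR (- (z * t)) * H t is an antiderivative of
   expR (- (z * t)) * g t. *)
Lemma laplace_FTC (g H : R -> R) z : 0 < z -> tempered g -> tempered H ->
  (forall t, 1 < t -> is_derive t 1 H (g t + z * H t)) ->
  laplace g z = - (expR (- z) * H 1).
Proof.
move=> z0 tg tH dH; have [C C0 gC] := laplace_dominated tg z0.
have [E E0 HE] := laplace_dominated tH z0.
(* Gives the right-hand side the shape of the antiderivative evaluated at [t = 1]. *)
rewrite -[in RHS](mulr1 z).
apply: (Rintegral_FTC_decay (H := fun t => expR (- (z * t)) * H t) (C := C)
  (a := z / 2)).
- by rewrite divr_gt0.
- by apply: continuous_laplace_integrand; case: tg.
- by apply: continuous_laplace_integrand; case: tH.
- move=> t /dH dHt; have := is_derive_expRN z t => dE; apply: is_derive_eq.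
  rewrite /GRing.scale/=; ring.
- by move=> t t1; exact: gC.
(* The boundary term at infinity vanishes, squeezed by the exponential majorant obtained for [H]. *)
- apply: norm_cvg0.
  apply: (@squeeze_cvgr _ _ _ _ (cst 0) (fun t => E * expR (- (z / 2 * t)))).
  + near=> t; rewrite normr_ge0/= HE//.
  + exact: cvg_cst.
  + rewrite -(mulr0 E); apply: cvgMl_tmp; apply: cvg_expRN.
    by rewrite divr_gt0.
Unshelve. all: by end_near. Qed.

End LaplaceLinear.

(** * Moments and Bessel functions *)

Section Moment.
Variable R : realType.
Local Notation mu := (@lebesgue_measure R).
Implicit Types (z t : R).

Let w t := Num.sqrt (t ^+ 2 - 1).

Let tempered_w : tempered w.
Proof.
apply: tempered_sqrt; apply: temperedD; last exact: tempered_cst.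
exact/temperedX/tempered_id.
Qed.

Definition moment k z := laplace (fun t => t ^+ k * w t) z.

Lemma tempered_moment k : tempered (fun t => t ^+ k * w t).
Proof. by apply: temperedM tempered_w; exact/temperedX/tempered_id. Qed.

Lemma Ck_open_moment n k : Ck_open n [set z : R | 0 < z] (moment k).
Proof. exact/Ck_open_laplace/tempered_moment. Qed.

Lemma is_derive_moment k z : 0 < z ->
  is_derive z 1 (moment k) (- moment k.+1 z).
Proof.
move=> z0; apply: is_derive_eq (is_derive_laplace (tempered_moment k) z0) _.
by congr (- _); apply: eq_laplace => t _; rewrite exprS mulrA.
Qed.

Lemma moment_gt0 k z : 0 < z -> 0 < moment k z.
Proof.
(* Compare with \int_1^oo (t - 1) e^(-zt) dt = e^(-z) / z^2. *)
move=> z0; have zN0 : z != 0 by rewrite gt_eqF.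
have tB1 : tempered (fun t => t - 1).
  by apply: temperedD; [exact: tempered_id|exact: tempered_cst].
apply: (@lt_le_trans _ _ (laplace (fun t => t - 1) z)); last first.
  apply: le_laplace => //; first exact: tempered_moment.
  move=> t t1; have t0 : 0 <= t - 1 by rewrite subr_ge0 ltW.
  apply: (@le_trans _ _ (w t)).
    rewrite -[leLHS](ger0_norm t0) -sqrtr_sqr ler_wsqrtr//.
    by move: t1; nra.
  by rewrite ler_peMl ?sqrtr_ge0// exprn_ege1// ltW.
(* The affine solution of H' = (t - 1) + z H, as [laplace_FTC] requires. *)
pose H t := - z^-1 * (t - 1) - z^-1 ^+ 2.
have tH : tempered H.
  apply: temperedD; last exact: tempered_cst.
  by apply: temperedM; first exact: tempered_cst.
have dH t : 1 < t -> is_derive t 1 H (t - 1 + z * H t).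
  move=> _; apply: is_derive_eq.
  by rewrite /GRing.scale/= /H; field.
rewrite (laplace_FTC z0 tB1 tH dH) /H subrr mulr0 sub0r mulrN opprK.
by rewrite mulr_gt0 ?expR_gt0// exprn_gt0// invr_gt0.
Qed.

Lemma laplace_moment20 z : 0 < z ->
  laplace (fun t => (t ^+ 2 - 1) * w t) z = moment 2 z - moment 0 z.
Proof.
move=> z0; have tc := @tempered_cst R; have tm := tempered_moment.
rewrite -[- moment 0 z]mulN1r -[X in _ + X](laplaceZ (-1) (tm 0%N) z0).
rewrite -laplaceD//; last first.
  exact: temperedM.
by apply: eq_laplace => t _; rewrite expr0 mulrBl mul1r mulN1r.
Qed.

Lemma moment_ibp z : 0 < z -> z * (moment 2 z - moment 0 z) = 3 * moment 1 z.
Proof.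
(* Integrate the derivative of - (t^2 - 1)^(3/2) e^(-zt). *)
move=> z0; have tw1 : tempered (fun t => (t ^+ 2 - 1) * w t).
  apply: temperedM tempered_w; apply: temperedD; last exact: tempered_cst.
  exact/temperedX/tempered_id.
have tc := @tempered_cst R; have tm := tempered_moment.
(* For H = - (t^2 - 1) w one has H' = - 3 t w, so H' - z H is the sum of the functions in [t0] and
   [t1]. The boundary term is zero since H vanishes at 1. *)
have t0 : tempered (fun t => z * ((t ^+ 2 - 1) * w t)) by exact: temperedM.
have t1 : tempered (fun t => - 3 * (t ^+ 1 * w t)) by exact: temperedM.
have := laplace_FTC z0 (temperedD t0 t1) (temperedN tw1).
rewrite laplaceD// !laplaceZ// expr1n subrr mul0r oppr0 mulr0 oppr0.
rewrite laplace_moment20//.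
move=> H; apply/eqP; rewrite -subr_eq0 -mulNr; apply/eqP; apply: H => t t_gt1.
have s0 : 0 < t ^+ 2 - 1 by nra.
have sN0 : w t != 0 by rewrite sqrtr_eq0 -ltNge.
have ds := is_derive1_sqrt s0.
apply: is_derive_eq.
have : w t ^+ 2 = t ^+ 2 - 1 by rewrite sqr_sqrtr// ltW.
rewrite /GRing.scale/= -/(w t) => w2.
by rewrite -w2; field.
Qed.

Lemma moment_cauchy_schwarz z : 0 < z ->
  moment 2 z ^+ 2 <= moment 1 z * moment 3 z.
Proof.
(* Expand 0 <= \int_1^oo t (t - a)^2 e^(-zt) sqrt(t^2 - 1) dt. *)
move=> z0; have m1 := moment_gt0 1 z0.
(* The minimiser of the quadratic M_3 - 2 a M_2 + a^2 M_1, whose value there is M_3 - M_2^2 /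
   M_1. *)
pose a := moment 2 z / moment 1 z.
have : 0 <= laplace (fun t => t ^+ 3 * w t + ((- a *+ 2) * (t ^+ 2 * w t) +
    a ^+ 2 * (t ^+ 1 * w t))) z.
  apply: laplace_ge0 => t t1.
  rewrite (_ : _ + _ = t * (t - a) ^+ 2 * w t); last by ring.
  by rewrite mulr_ge0 ?sqrtr_ge0// mulr_ge0 ?sqr_ge0// ltW// (lt_trans ltr01).
have tm := tempered_moment; have tc := @tempered_cst R.
rewrite laplaceD//; last by apply: temperedD; exact: temperedM.
rewrite laplaceD//; try exact: temperedM.
rewrite !laplaceZ// -/(moment _ _) -/(moment _ _) -/(moment _ _).
have -> : moment 2 z = a * moment 1 z by rewrite divfK// gt_eqF.
rewrite -(pmulr_rge0 _ m1) => H; rewrite -subr_ge0; apply: le_trans H _.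
rewrite le_eqVlt; apply/orP; left; apply/eqP; ring.
Qed.

(** Substitution l = z t. With index [j.+1] the exponent is j + 1/2, so the real power splits into a
    natural power and a square root, both continuous on the whole line. *)
Lemma besselK_laplace j z : 0 < z -> besselK j.+1 z =
  2 ^+ j.+1 * (j.+1)`!%:R / ((2 * j.+1)`!)%:R * z ^+ j.+1 *
  laplace (fun t => (t ^+ 2 - 1) ^+ j * w t) z.
Proof.
move=> z0; have zN0 : z != 0 by rewrite gt_eqF.
pose G l := expR (- l) * ((l ^+ 2 - z ^+ 2) ^+ j * Num.sqrt (l ^+ 2 - z ^+ 2)).
pose q (l : R) := l ^+ 2 - z ^+ 2.
have cq : continuous q.
  by move=> l; apply: cvgB; [exact: exprn_continuous|exact: cvg_cst].
have cG : continuous G.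
  have c1 : continuous (fun l : R => expR (- l)).
    move=> l; apply: (@continuous_comp _ _ _ -%R expR).
      exact: opp_continuous.
    exact: continuous_expR.
  have c2 : continuous (fun l : R => (l ^+ 2 - z ^+ 2) ^+ j).
    by move=> l; apply: (@continuous_comp _ _ _ q (fun x => x ^+ j));
      [exact: cq|exact: exprn_continuous].
  have c3 : continuous (fun l : R => Num.sqrt (l ^+ 2 - z ^+ 2)).
    by move=> l; apply: (@continuous_comp _ _ _ q Num.sqrt);
      [exact: cq|exact: sqrt_continuous].
  by move=> l; apply: cvgM; [exact: c1|apply: cvgM; [exact: c2|exact: c3]].
have mG A : measurable_fun A (EFin \o G).
  apply/measurable_EFinP; apply: measurable_funTS.
  exact: continuous_measurable_fun.
rewrite /besselK.
have -> : \int[mu]_(l in `]z, +oo[)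
    (expR (- l) * (l ^+ 2 - z ^+ 2) `^ (j.+1%:R - 2^-1)) =
    \int[mu]_(l in `]z, +oo[) G l.
  apply: eq_Rintegral => l; rewrite inE/= in_itv/= andbT => zl.
  have q0 : 0 < l ^+ 2 - z ^+ 2 by nra.
  congr (_ * _); rewrite (_ : j.+1%:R - 2^-1 = j%:R + 2^-1); last first.
    by rewrite -(natr1 j); field.
  by rewrite powRD ?gt_eqF ?implybT// powR_mulrn ?powR12_sqrt// ltW.
have -> : \int[mu]_(l in `]z, +oo[) G l =
    \int[mu]_(l in `]z * 1, +oo[) G l by rewrite mulr1.
have dF t : is_derive t 1 ( *%R z) z.
  by apply: is_derive_eq; rewrite /GRing.scale/= mulr1.
have dFE : derive1 ( *%R z) = cst z.
  by apply/funext => t; rewrite derive1E; case: (dF t).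
have -> : \int[mu]_(l in `]z * 1, +oo[) G l =
    \int[mu]_(t in `]1, +oo[) (((G \o *%R z) * derive1 ( *%R z)) t).
  (* The substitution rule is applied on half-lines containing their endpoint, so the endpoints are
     added first. *)
  rewrite /Rintegral !integral_itv_obnd_cbnd//; last first.
    apply/measurable_EFinP; apply: measurable_funTS.
    apply: continuous_measurable_fun => t; rewrite dFE.
    apply: cvgM; last exact: cvg_cst.
    by apply: (@continuous_comp _ _ _ ( *%R z) G);
      [exact: mulrl_continuous|exact: cG].
  rewrite (@increasing_ge0_integration_by_substitutiony R ( *%R z) G 1)//.
  - by move=> x y _ _; rewrite ltr_pM2l.
  - by rewrite dFE => x _; exact: cvg_cst.
  - by rewrite dFE; exact: is_cvg_cst.
  - by rewrite dFE; exact: is_cvg_cst.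
  - split; first by move=> x _; case: (dF x).
    by apply: cvg_at_right_filter; exact: mulrl_continuous.
  - exact: gt0_cvgMry.
  - exact: continuous_subspaceT.
  - rewrite mulr1 => l; rewrite in_itv/= andbT => zl.
    rewrite mulr_ge0 ?expR_ge0// mulr_ge0 ?sqrtr_ge0// exprn_ge0//.
    by nra.
(* The power contributes z^(2j), the square root z and the Jacobian z; the prefactor z^-(j+1) will
   leave z^(j+1). *)
have -> : \int[mu]_(t in `]1, +oo[) (((G \o *%R z) * derive1 ( *%R z)) t) =
    laplace (fun t => z ^+ (2 * j.+1) * ((t ^+ 2 - 1) ^+ j * w t)) z.
  apply: eq_Rintegral => t _; rewrite dFE /= fctE/= /G /=.
  have -> : (z * t) ^+ 2 - z ^+ 2 = z ^+ 2 * (t ^+ 2 - 1) by ring.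
  rewrite sqrtrM ?sqr_ge0// sqrtr_sqr ger0_norm ?ltW// -/(w t).
  rewrite (exprM z 2 j.+1) (exprS (z ^+ 2) j) (exprMn j (z ^+ 2)); ring.
rewrite laplaceZ//; last first.
  apply: temperedM tempered_w; apply: temperedX.
  apply: temperedD; last exact: tempered_cst.
  exact/temperedX/tempered_id.
rewrite mulrA; congr (_ * _); rewrite -!mulrA; do 3 congr (_ * _).
by rewrite mul2n -addnn exprD mulKf// expf_neq0.
Qed.

Lemma besselK1 z : 0 < z -> besselK 1 z = z * moment 0 z.
Proof.
move=> z0; rewrite besselK_laplace// /moment expr1 factS.
rewrite (_ : _ * _ / _ = 1) ?mul1r//.
by rewrite !factS fact0 /=; field.
Qed.

(** The prefactor 2^2 2! / 4! = 1/3 cancels the 3 of [moment_ibp], which also consumes one factor of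
    z^2. *)
Lemma besselK2 z : 0 < z -> besselK 2 z = z * moment 1 z.
Proof.
move=> z0; rewrite besselK_laplace//.
rewrite laplace_moment20//.
by rewrite (expr2 z) -!mulrA moment_ibp// !factS fact0 /=; field.
Qed.

End Moment.

(** * The inverse of the entropy-pressure map *)

Section Inverse.
Variables (R : realType) (I : set R) (f g : R -> R).
Hypotheses (oI : open I) (Cf : forall k, Ck_open k I f).
Hypothesis fK : {in I, cancel f g}.
Hypothesis df0 : forall x, I x -> 'D_1 f x != 0.

Let near_I x : I x -> \forall y \near x, I y.
Proof. by move=> Ix; exact: open_nbhs_nbhs. Qed.

Let near_fK x : I x -> {near x, cancel f g}.
Proof. by move=> /near_I; apply: filterS => y Iy; apply: fK; rewrite inE. Qed.

Let near_cf x : I x -> {near x, continuous f}.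
Proof. by move=> /near_I; apply: filterS => y; exact: (Cf 0). Qed.

Let gf x : I x -> g (f x) = x.
Proof. by move=> Ix; rewrite fK ?inE. Qed.

(** On the line, a continuous [f] with left inverse [g] makes [g] continuous near [f x] and also a
    right inverse there, so every point near [f x] is a value of [f] on [I]. *)
Lemma open_image_inverse : open (f @` I).
Proof.
rewrite openE => _ [x Ix <-]; rewrite /interior.
have cg : {for f x, continuous g}.
  exact: nbhs_singleton (near_can_continuous (near_fK Ix) (near_cf Ix)).
have gI : \forall y \near f x, I (g y).
  by apply: cg; rewrite gf//; exact: near_I.
have fgK := near_continuous_can_sym (near_cf Ix) (near_fK Ix).
by near=> y; exists (g y); [near: y|near: y].
Unshelve. all: by end_near. Qed.

(** Bootstrapping with g' = 1 / (f' o g): if [g] is of class C^k then so is the right-hand side,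
    hence [g] is of class C^(k+1). *)
Lemma Ck_open_inverse k : Ck_open k (f @` I) g.
Proof.
elim: k => [|k IH].
  move=> _ [x Ix <-].
  exact: nbhs_singleton (near_can_continuous (near_fK Ix) (near_cf Ix)).
have oJ := open_image_inverse.
have gI y : (f @` I) y -> I (g y) by move=> [x Ix <-]; rewrite gf.
apply: (Ck_open_is_derive (f' := GRing.inv \o ('D_1 f \o g))) => //.
  move=> _ [x Ix <-] /=; rewrite gf//.
  apply: is_derive_inverse; [exact: near_fK|exact: near_cf| |exact: df0].
  by apply/derivableP/derivable1_diffP; exact: (Cf 1).1.
apply: Ck_open_comp (@Ck_open_inv R k) _ => //.
  by move=> y /gI; exact: df0.
exact: Ck_open_comp gI ((Cf k.+1).2 1) IH.
Qed.

End Inverse.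

(** * Strict monotonicity and smooth inversion of [phi] *)

Section Phi.
Variable R : realType.
Implicit Types z : R.
Local Notation P := [set z : R | 0 < z].

(* The part of the entropy per particle, in units of kB, that depends on z when
   the pressure is held fixed. *)
Definition phi z := ln (moment 1 z) - ln z + z * (moment 2 z / moment 1 z).

Lemma Ck_open_phi k : Ck_open k P phi.
Proof.
have oP := @open_pos R.
have Cid : Ck_open k P (@id R).
  exact: (Ck_open_linear (f := idfun) k oP (fun x => @cvg_id _ _)).
have C1 := Ck_open_moment R k 1; have C2 := Ck_open_moment R k 2.
have Cl : Ck_open k P (@ln R \o moment 1).
  by apply: (Ck_open_comp oP _ (Ck_open_ln R k) C1) => z; exact: moment_gt0.
have CV : Ck_open k P (GRing.inv \o moment 1).
  apply: (Ck_open_comp oP _ (Ck_open_inv R k) C1) => z /(moment_gt0 1) m1.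
  by rewrite /= gt_eqF.
have -> : phi = (((@ln R \o moment 1) \+ (cst (-1) \* @ln R)) \+
  (id \* (moment 2 \* (GRing.inv \o moment 1)))).
  by apply/funext => z; rewrite /phi/= mulN1r.
apply: Ck_openD => //; last by do 2 apply: Ck_openM => //.
apply: Ck_openD => //; apply: Ck_openM => //; first exact: Ck_open_cst.
exact: Ck_open_ln.
Qed.

Lemma derive_phi_lt0 z : 0 < z -> 'D_1 phi z < 0.
Proof.
move=> z0; have m1 := moment_gt0 1 z0.
have zN0 : z != 0 by rewrite gt_eqF.
have m1N0 : moment 1 z != 0 by rewrite gt_eqF.
have d1 := is_derive_moment 1 z0; have d2 := is_derive_moment 2 z0.
have dl := is_derive1_ln z0; have dl1 := is_derive1_ln m1.
have dV := is_deriveV m1N0 d1.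
(* The term - M_2 / M_1 from ln M_1 cancels the term M_2 / M_1 from the factor z. *)
have dphi : is_derive z 1 phi
    (- z^-1 -
     z * (moment 1 z * moment 3 z - moment 2 z ^+ 2) / moment 1 z ^+ 2).
  apply: is_derive_eq.
  rewrite /GRing.scale/=; field.
  by rewrite m1N0.
have [_ ->] := dphi.
have zi : 0 < z^-1 by rewrite invr_gt0.
rewrite subr_lt0 (lt_le_trans (_ : _ < 0))// ?oppr_lt0//.
rewrite divr_ge0 ?sqr_ge0// mulr_ge0 ?(ltW z0)// subr_ge0.
exact: moment_cauchy_schwarz.
Qed.

Lemma phi_inj z z' : 0 < z -> 0 < z' -> phi z = phi z' -> z = z'.
Proof.
have decr x y : 0 < x -> x < y -> phi y < phi x.
  move=> x0 xy.
  have dphi t : x <= t -> derivable phi t 1.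
    move=> xt; apply/derivable1_diffP; apply: (Ck_open_phi 1).1 => /=.
    exact: lt_le_trans xt.
  apply: (@ltr0_derive1_decr _ phi x y) => //.
  - by move=> t; rewrite in_itv/= => /andP[/ltW xt _]; exact: dphi.
  - move=> t; rewrite in_itv/= => /andP[xt _]; rewrite derive1E.
    by apply: derive_phi_lt0; exact: lt_trans xt.
  - apply: derivable_within_continuous => t; rewrite in_itv/= => /andP[xt _].
    exact: dphi.
move=> z0 z'0 E; case: (ltgtP z z') => [H|H|]; last exact.
  by have := decr _ _ z0 H; rewrite E ltxx.
by have := decr _ _ z'0 H; rewrite E ltxx.
Qed.

(** A chosen positive preimage, unique by [phi_inj]; the default 0 is taken only off the image of
    the positive half-line. *)
Definition phi_inv (y : R) : R := xget 0 [set z | 0 < z /\ phi z = y].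

Lemma phiK : {in P, cancel phi phi_inv}.
Proof.
move=> z; rewrite inE /= => z0.
have [w0 wE] : [set x | 0 < x /\ phi x = phi z] (phi_inv (phi z)).
  by apply: xgetPex; exists z.
exact: phi_inj.
Qed.

Lemma open_phi_image : open (phi @` P).
Proof.
apply: open_image_inverse (@open_pos R) Ck_open_phi phiK.
Qed.

Lemma Ck_open_phi_inv k : Ck_open k (phi @` P) phi_inv.
Proof.
apply: Ck_open_inverse (@open_pos R) Ck_open_phi phiK _ _.
by move=> z z0; rewrite lt_eqF// derive_phi_lt0.
Qed.

End Phi.

(** * Smoothness and inversion of the two-variable map *)

Section EntropyPressure.
Variables (R : realType) (m0 c kB h : R).
Hypotheses (m0_gt0 : 0 < m0) (c_gt0 : 0 < c) (kB_gt0 : 0 < kB) (h_gt0 : 0 < h).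

Let A : R := 4 * pi * expR 1 ^+ 4 * m0 ^+ 3 * c ^+ 3 * (h ^+ 3)^-1.

Let A_gt0 : 0 < A.
Proof.
by rewrite !mulr_gt0 ?invr_gt0 ?exprn_gt0 ?pi_gt0 ?expR_gt0.
Qed.

Let mc : R := m0 * c ^+ 2.

Let mc_gt0 : 0 < mc.
Proof. by rewrite mulr_gt0// exprn_gt0. Qed.

(** The factors z cancel in K_2 / z = M_1 and in K_1 / K_2 = M_0 / M_1. This form in [n] and [z]
    serves the smoothness of the direct map. *)
Lemma entropyE n z : 0 < n -> 0 < z -> entropy m0 c kB h n z =
  kB * (ln A - ln n + (ln (moment 1 z) + z * (moment 0 z / moment 1 z))).
Proof.
move=> n0 z0; have M1 := moment_gt0 1 z0; have zN0 : z != 0 by rewrite gt_eqF.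
rewrite /entropy besselK1// besselK2// -/A; congr (kB * _).
rewrite [z * moment 1 z / z]mulrAC divff// mul1r.
have -> : z * moment 0 z / (z * moment 1 z) = moment 0 z / moment 1 z.
  by rewrite -mulf_div divff// mul1r.
(* Made opaque so that [lnM] does not split the constant into its factors. *)
move: A_gt0; generalize A => A' A'_gt0.
rewrite !lnM ?posrE ?mulr_gt0 ?invr_gt0 ?expR_gt0// lnV ?posrE// expRK.
by rewrite addrA.
Qed.

(** This form serves the inversion: n = p z / (m0 c^2) trades [n] for the pressure, and [moment_ibp]
    turns z M_0 / M_1 into z M_2 / M_1 - 3. *)
Lemma entropy_phi n z : 0 < n -> 0 < z -> entropy m0 c kB h n z =
  kB * (ln A + ln mc - 3 - ln (pressure m0 c n z) + phi z).
Proof.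
move=> n0 z0; rewrite entropyE//; congr (kB * _).
have M1 := moment_gt0 1 z0; have zN0 : z != 0 by rewrite gt_eqF.
have M1N0 : moment 1 z != 0 by rewrite gt_eqF.
move: mc_gt0; rewrite /pressure -/mc; generalize mc => mc' mc'_gt0.
generalize A => A'.
rewrite !lnM ?posrE ?mulr_gt0 ?invr_gt0// lnV ?posrE// /phi.
have -> : z * (moment 0 z / moment 1 z) =
    z * (moment 2 z / moment 1 z) - 3.
  have : z * moment 0 z = z * moment 2 z - 3 * moment 1 z.
    by rewrite -moment_ibp//; ring.
  by rewrite !mulrA => ->; field.
ring.
Qed.

Let Q : set (R * R) := [set x | 0 < x.1 /\ 0 < x.2].

Let open_fst_pos : open [set x : R * R | 0 < x.1].
Proof.
apply: (@open_comp _ _ fst [set x : R | 0 < x]) => [x _|]; last exact: open_gt.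
exact: cvg_fst.
Qed.

Let open_snd_pos : open [set x : R * R | 0 < x.2].
Proof.
apply: (@open_comp _ _ snd [set x : R | 0 < x]) => [x _|]; last exact: open_gt.
exact: cvg_snd.
Qed.

Let open_Q : open Q.
Proof. exact: openI. Qed.

Let Ck_fst k (U : set (R * R)) : open U -> Ck_open k U fst.
Proof. by move=> oU; apply: Ck_open_linear => // x; exact: cvg_fst. Qed.

Let Ck_snd k (U : set (R * R)) : open U -> Ck_open k U snd.
Proof. by move=> oU; apply: Ck_open_linear => // x; exact: cvg_snd. Qed.

Lemma Ck_open_entropy_pressure k : Ck_open k Q (entropy_pressure m0 c kB h).
Proof.
have Q1 (x : R * R) : Q x -> 0 < x.1 by case.
have Q2 (x : R * R) : Q x -> 0 < x.2 by case.
have C1 := Ck_fst k open_Q; have C2 := Ck_snd k open_Q.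
have Cc (a : R) := Ck_open_cst k Q a.
have CM j := Ck_open_comp open_Q Q2 (Ck_open_moment R k j) C2.
have Cln := Ck_open_comp open_Q Q1 (Ck_open_ln R k) C1.
have ClM : Ck_open k Q (@ln R \o (moment 1 \o snd)).
  apply: (Ck_open_comp open_Q _ (Ck_open_ln R k) (CM 1%N)) => x /Q2.
  exact: moment_gt0.
have CVM : Ck_open k Q (GRing.inv \o (moment 1 \o snd)).
  apply: (Ck_open_comp open_Q _ (Ck_open_inv R k) (CM 1%N)) => x /Q2 x0.
  by rewrite /= gt_eqF// moment_gt0.
have CVz : Ck_open k Q (GRing.inv \o snd).
  apply: (Ck_open_comp open_Q _ (Ck_open_inv R k) C2) => x /Q2 x0.
  by rewrite /= gt_eqF.
(* [e] and [p] agree with the two components on [Q] and are built from pointwise operators, to which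
   the closure lemmas apply. *)
pose e : R * R -> R := cst kB \*
  ((cst (ln A) \+ (cst (-1) \* (@ln R \o fst))) \+
  ((@ln R \o (moment 1 \o snd)) \+
   (snd \* ((moment 0 \o snd) \* (GRing.inv \o (moment 1 \o snd)))))).
pose p : R * R -> R := cst mc \* (fst \* (GRing.inv \o snd)).
have Ce : Ck_open k Q e.
  by do ![exact: Cc|exact: CM|assumption|apply: Ck_openM|apply: Ck_openD].
have Cp : Ck_open k Q p.
  by do ![exact: Cc|assumption|apply: Ck_openM].
apply: Ck_open_eq (Ck_open_pair open_Q Ce Cp) => // -[n z].
rewrite inE => -[/= n0 z0]; congr (_, _).
  by rewrite entropyE// /e /= mulN1r.
by rewrite /p /pressure /= mulrA.
Qed.

(** [entropy_phi] solved for [phi z], with [y] the pair of entropy and pressure. *)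
Let q (y : R * R) : R := y.1 / kB - (ln A + ln mc - 3) + ln y.2.

(** First z is recovered from [q y], then n from p = m0 c^2 n / z. *)
Let G (y : R * R) : R * R := (y.2 * phi_inv (q y) / mc, phi_inv (q y)).

(** An open set containing the image of [Q]: one neighborhood for all points in the proof that [G]
    is smooth. *)
Let U : set (R * R) := [set y | 0 < y.2 /\ (@phi R @` [set z | 0 < z]) (q y)].

Let q_entropy_pressure n z : 0 < n -> 0 < z ->
  q (entropy_pressure m0 c kB h (n, z)) = phi z.
Proof.
move=> n0 z0; rewrite /q /= entropy_phi//.
by field; rewrite gt_eqF.
Qed.

Let G_entropy_pressure n z : 0 < n -> 0 < z ->
  G (entropy_pressure m0 c kB h (n, z)) = (n, z).
Proof.
move=> n0 z0; rewrite /G q_entropy_pressure// phiK ?inE//.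
congr (_, _); rewrite /= /pressure -/mc; field.
by rewrite !gt_eqF.
Qed.

Let U_entropy_pressure n z : 0 < n -> 0 < z ->
  U (entropy_pressure m0 c kB h (n, z)).
Proof.
move=> n0 z0; split; first by rewrite /= !mulr_gt0// ?invr_gt0// exprn_gt0.
by rewrite q_entropy_pressure//; exists z.
Qed.

Let Ck_q k : Ck_open k [set y : R * R | 0 < y.2] q.
Proof.
have o2 := open_snd_pos; have C1 := Ck_fst k o2; have C2 := Ck_snd k o2.
have Cl := Ck_open_comp o2 (fun _ => id) (Ck_open_ln R k) C2.
have -> : q =
    ((fst \* cst kB^-1) \+ cst (- (ln A + ln mc - 3))) \+ (@ln R \o snd).
  by [].
by do ![exact: Ck_open_cst|assumption|apply: Ck_openM|apply: Ck_openD].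
Qed.

Let open_U : open U.
Proof.
rewrite openE => y [y2 qy]; rewrite /interior.
have cq : {for y, continuous q} := Ck_q 0 _ y2.
near=> x; split; near: x.
  exact: open_nbhs_nbhs.
by apply: cq; apply: open_nbhs_nbhs; split=> //; exact: open_phi_image.
Unshelve. all: by end_near. Qed.

Let Ck_G k : Ck_open k U G.
Proof.
have Cq : Ck_open k U q by apply: Ck_openW (Ck_q k) => y [].
have Cinv : Ck_open k U (@phi_inv R \o q).
  by apply: (Ck_open_comp open_U _ (Ck_open_phi_inv R k) Cq) => y [].
have -> : G = (fun y =>
    ((snd \* (@phi_inv R \o q) \* cst mc^-1) y, (@phi_inv R \o q) y)).
  by [].
apply: Ck_open_pair => //.
by do ![exact: Ck_open_cst|exact: Ck_snd|assumption|apply: Ck_openM].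
Qed.

Lemma entropy_pressure_smooth_inverse :
  smooth_on Q (entropy_pressure m0 c kB h) /\
  exists G0 : R * R -> R * R,
  (forall x, Q x -> G0 (entropy_pressure m0 c kB h x) = x) /\
  smooth_on (entropy_pressure m0 c kB h @` Q) G0.
Proof.
split.
  move=> x Qx; exists Q, (entropy_pressure m0 c kB h).
  by split=> // k; exact: Ck_open_entropy_pressure.
exists G; split=> [[n z] [/=]|]; first exact: G_entropy_pressure.
move=> _ [[n z] [/= n0 z0] <-]; exists U, G.
by split=> //; exact: U_entropy_pressure.
Qed.

End EntropyPressure.

(** The local extension at a point of [B] serves unchanged on [A]. This passes from the image of the
    open quadrant to that of the two ranges of z, where the domain is not open. *)
Lemma smooth_onW (R : realType) (V W : normedModType R) (A B : set V)
  (f : V -> W) : A `<=` B -> smooth_on B f -> smooth_on A f.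
Proof.
move=> AB sf a /AB /sf [U [g [oU Ua Cg fg]]]; exists U, g; split=> // x /AB.
exact: fg.
Qed.

Theorem lemma3p5 (R : realType) (m0 c kB h : R)
    (m0_gt0 : 0 < m0) (c_gt0 : 0 < c) (kB_gt0 : 0 < kB) (h_gt0 : 0 < h) :
  let F : R * R -> R * R := entropy_pressure m0 c kB h in
  let Q : set (R * R) := [set x | 0 < x.1 /\ 0 < x.2] in
  let D : set (R * R) :=
    [set x | 0 < x.1 /\ (0 < x.2 <= 10^-1 \/ 70 <= x.2)] in
  smooth_on Q F /\
  exists G : R * R -> R * R,
    (forall x, D x -> G (F x) = x) /\ smooth_on (F @` D) G.
Proof.
move=> F Q D.
have DQ : D `<=` Q.
  move=> x [x1 x2]; split=> //; case: x2 => [/andP[]//|].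
  exact: lt_le_trans.
have [sF [G [GF sG]]] :=
  entropy_pressure_smooth_inverse m0_gt0 c_gt0 kB_gt0 h_gt0.
split=> //; exists G; split=> [x /DQ|]; first exact: GF.
by apply: smooth_onW sG; exact: image_subset.
Qed.
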